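(* Let $K:\mathbb{Z}^2\to(0,\infty)$ and assume that the limits $$\Lambda_+:=\lim_{j\to\infty}\frac{K(j,0)}{K(1,j-1)}\in(0,\infty],\qquad\Lambda_-:=\lim_{j\to-\infty}\frac{K(0,j)}{K(j+1,-1)}\in(0,\infty]$$ exist and that $\mathbf{I}_K:=\big((\Lambda_-\kappa)^{-1},\Lambda_+\kappa\big)\ne\emptyset$, where $\kappa:=\sqrt{K(1,-1)/K(0,0)}$. For $\phi\in\mathbf{I}_K$ let $\Phi(\phi)=f_\phi\in\ell_{1,1}(\mathbb{Z})$ be given by $f_\phi(k)=\psi(k)\phi^k/Z(\phi)$. Then the function $\mathbf{I}_K\to\mathbb{R}$, $\phi\mapsto q(\Phi(\phi))$, is continuously differentiable and $\frac{d}{d\phi}q(\Phi(\phi))>0$ for all $\phi\in\mathbf{I}_K$.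
   Context: $\ell_{1,1}(\mathbb{Z})$ is the space of functions $g:\mathbb{Z}\to\mathbb{R}$ with $\sum_{k\in\mathbb{Z}}(1+|k|)|g(k)|<\infty$, and for such $g$ the total charge is $q(g)=\sum_{k\in\mathbb{Z}}k\,g(k)$. Conventions: $1/\infty:=0$. Define $$\tilde\psi(k)=\begin{cases}\prod_{j=1}^k\frac{K(1,j-1)}{K(j,0)},&k>0,\\ 1,&k=0,\\ \prod_{j=k}^{-1}\frac{K(j+1,-1)}{K(0,j)},&k<0,\end{cases}\qquad\psi(k)=\tilde\psi(k)\kappa^{-|k|},\qquad Z(\phi)=\sum_{l\in\mathbb{Z}}\psi(l)\phi^l .$$ For $\phi\in\mathbf{I}_K$ one has $Z(\phi)<\infty$ and $f_\phi\in\ell_{1,1}(\mathbb{Z})$. *)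

(* Defs.v *)
From Stdlib Require Import Reals ZArith List.
From Coquelicot Require Import Coquelicot.
Open Scope R_scope.

(** Sums over [Z], split as [k >= 0] and [k <= -1].  Each half is a Coquelicot
    series; for a nonnegative [a], [ex_seriesZ a] says that the sum is finite. *)
Definition ex_seriesZ (a : Z -> R) : Prop :=
  ex_series (fun n : nat => a (Z.of_nat n)) /\
  ex_series (fun n : nat => a (- Z.of_nat (S n))%Z).

(** Like [Series], meaningful only for convergent sums. *)
Definition SeriesZ (a : Z -> R) : R :=
  Series (fun n : nat => a (Z.of_nat n)) +
  Series (fun n : nat => a (- Z.of_nat (S n))%Z).

(** Product of [a j] over the integers [m <= j <= n]. *)
Definition prodZ (m n : Z) (a : Z -> R) : R :=
  fold_right Rmult 1
    (map (fun i : nat => a (m + Z.of_nat i)%Z) (seq 0 (Z.to_nat (n - m + 1)))).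

Definition ell11 (g : Z -> R) : Prop :=
  ex_seriesZ (fun k => (1 + Rabs (IZR k)) * Rabs (g k)).

Definition charge (g : Z -> R) : R := SeriesZ (fun k => IZR k * g k).

Definition kappa (K : Z -> Z -> R) : R := sqrt (K 1%Z (-1)%Z / K 0%Z 0%Z).

Definition psi_tilde (K : Z -> Z -> R) (k : Z) : R :=
  match k with
  | Zpos _ => prodZ 1 k (fun j => K 1%Z (j - 1)%Z / K j 0%Z)
  | Z0 => 1
  | Zneg _ => prodZ k (-1) (fun j => K (j + 1)%Z (-1)%Z / K 0%Z j)
  end.

Definition psi (K : Z -> Z -> R) (k : Z) : R :=
  psi_tilde K k * powerRZ (kappa K) (- Z.abs k).

Definition partition_fun (K : Z -> Z -> R) (phi : R) : R :=
  SeriesZ (fun l => psi K l * powerRZ phi l).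

Definition f_eq (K : Z -> Z -> R) (phi : R) (k : Z) : R :=
  psi K k * powerRZ phi k / partition_fun K phi.

(** The limits along [j -> +oo] and [j -> -oo] in [Z], with [j = n] and
    [j = - n] for [n : nat]. *)
Definition is_Lambda_plus (K : Z -> Z -> R) (L : Rbar) : Prop :=
  is_lim_seq
    (fun n : nat => let j := Z.of_nat n in K j 0%Z / K 1%Z (j - 1)%Z) L.

Definition is_Lambda_minus (K : Z -> Z -> R) (L : Rbar) : Prop :=
  is_lim_seq
    (fun n : nat => let j := (- Z.of_nat n)%Z in
       K 0%Z j / K (j + 1)%Z (-1)%Z) L.

(** [Rbar_inv p_infty = 0], which is the convention [1/oo = 0]. *)
Definition I_K (K : Z -> Z -> R) (Lm Lp : Rbar) (phi : R) : Prop :=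
  Rbar_lt (Rbar_inv (Rbar_mult Lm (kappa K))) phi /\
  Rbar_lt phi (Rbar_mult Lp (kappa K)).

(** Two-sided derivatives, so intended for open [D]. *)
Definition C1_on (D : R -> Prop) (f : R -> R) : Prop :=
  forall x, D x -> ex_derive f x /\ continuous (Derive f) x.

(* Main.v *)
Require Import Defs.
From Stdlib Require Import Reals ZArith List Lra Lia.
From Coquelicot Require Import Coquelicot.
Open Scope R_scope.

(** By the ratio test, the Laurent series [M_j x = sum k^j psi_k x^k] converge on
    the annulus [I_K] and satisfy [x M_j' = M_(j+1)] there.  The charge is the
    mean [M_1 / M_0], so [x] times its derivative is the variance
    [M_2 / M_0 - (M_1 / M_0)^2], which is positive. *)

(** * Ratio test and recursions for the weights *)

(** D'Alembert's test with the quotient inverted, so that its limit is the radius itself. This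
    treats finite and infinite [L] uniformly, as the limits [Lp] and [Lm] require. *)
Lemma CV_radius_of_ratio (a : nat -> R) (L : Rbar) :
  (forall n, 0 < a n) -> Rbar_lt 0 L ->
  is_lim_seq (fun n => a n / a (S n)) L -> CV_radius a = L.
Proof.
intros Ha HL Hlim.
assert (Hnz : forall n, a n <> 0) by (intro n; specialize (Ha n); lra).
assert (Hinv : is_lim_seq (fun n => Rabs (a (S n) / a n)) (Rbar_inv L)).
{ apply is_lim_seq_ext with (fun n => / (a n / a (S n))).
  - intro n. rewrite Rabs_pos_eq.
    + field; auto.
    + apply Rlt_le, Rdiv_lt_0_compat; auto.
  - apply is_lim_seq_inv; auto.
    intro E; rewrite E in HL; simpl in HL; lra. }
destruct L as [l| |]; simpl in HL, Hinv.
- rewrite (CV_radius_finite_DAlembert a (/ l)); auto.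
  + now rewrite Rinv_inv.
  + now apply Rinv_0_lt_compat.
- now apply CV_radius_infinite_DAlembert.
- contradiction.
Qed.

Lemma Series_ge0 (u : nat -> R) :
  (forall n, 0 <= u n) -> ex_series u -> 0 <= Series u.
Proof.
intros Hu Hex.
replace 0 with (Series (fun n => 0 * u n)) by (rewrite Series_scal_l; ring).
apply Series_le; auto.
intro n; specialize (Hu n); lra.
Qed.

Lemma prodZ_recl (m n : Z) (a : Z -> R) :
  (m <= n)%Z -> prodZ m n a = a m * prodZ (m + 1) n a.
Proof.
intro Hmn. unfold prodZ.
replace (Z.to_nat (n - m + 1)) with (S (Z.to_nat (n - (m + 1) + 1))) by lia.
simpl. rewrite <- seq_shift, map_map. f_equal.
- f_equal; lia.
- f_equal. apply map_ext. intro i. f_equal; lia.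
Qed.

Lemma prodZ_recr (m n : Z) (a : Z -> R) :
  (m <= n)%Z -> prodZ m n a = prodZ m (n - 1) a * a n.
Proof.
intro Hmn. unfold prodZ.
replace (Z.to_nat (n - m + 1)) with (S (Z.to_nat (n - 1 - m + 1))) by lia.
rewrite seq_S, map_app, fold_right_app. simpl.
replace (m + Z.of_nat (Z.to_nat (n - 1 - m + 1)))%Z with n by lia.
generalize (map (fun i : nat => a (m + Z.of_nat i)%Z)
  (seq 0 (Z.to_nat (n - 1 - m + 1)))).
intro l; induction l as [|x l IH]; simpl; [ring | rewrite IH; ring].
Qed.

Lemma psi_tilde_succ (K : Z -> Z -> R) (n : nat) :
  psi_tilde K (Z.of_nat (S n)) =
  psi_tilde K (Z.of_nat n)
  * (K 1%Z (Z.of_nat n) / K (Z.of_nat (S n)) 0%Z).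
Proof.
(* The branch [Z0] is the empty product, so one formula covers all [k], including the step from 0 to
   1. *)
assert (H : forall k : nat, psi_tilde K (Z.of_nat k) =
  prodZ 1 (Z.of_nat k) (fun j => K 1%Z (j - 1)%Z / K j 0%Z))
  by (now intros [|k]).
rewrite 2!H, prodZ_recr by lia.
now replace (Z.of_nat (S n) - 1)%Z with (Z.of_nat n) by lia.
Qed.

Lemma psi_tilde_pred (K : Z -> Z -> R) (n : nat) :
  psi_tilde K (- Z.of_nat (S n)) =
  psi_tilde K (- Z.of_nat n)
  * (K (- Z.of_nat n)%Z (-1)%Z / K 0%Z (- Z.of_nat (S n))%Z).
Proof.
assert (H : forall k : nat, psi_tilde K (- Z.of_nat k) =
  prodZ (- Z.of_nat k) (-1) (fun j => K (j + 1)%Z (-1)%Z / K 0%Z j))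
  by (now intros [|k]).
rewrite 2!H, prodZ_recl by lia.
replace (- Z.of_nat (S n) + 1)%Z with (- Z.of_nat n)%Z by lia.
apply Rmult_comm.
Qed.

(** * Positivity of [psi] and the radii of its two halves *)

Section Psi.

Variable K : Z -> Z -> R.
Hypothesis K_pos : forall i j : Z, 0 < K i j.

Lemma kappa_pos : 0 < kappa K.
Proof. apply sqrt_lt_R0, Rdiv_lt_0_compat; apply K_pos. Qed.

Lemma psi_tilde_pos (k : Z) : 0 < psi_tilde K k.
Proof.
assert (H : forall n : nat,
  0 < psi_tilde K (Z.of_nat n) /\ 0 < psi_tilde K (- Z.of_nat n)).
{ intro n; induction n as [|n [IH1 IH2]].
  - simpl; lra.
  - rewrite psi_tilde_succ, psi_tilde_pred.
    split; apply Rmult_lt_0_compat; auto; apply Rdiv_lt_0_compat; apply K_pos. }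
destruct (Z.le_ge_cases 0 k).
- rewrite <- (Z2Nat.id k) by lia. apply H.
- replace k with (- Z.of_nat (Z.to_nat (- k)))%Z by lia. apply H.
Qed.

Lemma psi_pos (k : Z) : 0 < psi K k.
Proof.
apply Rmult_lt_0_compat; [apply psi_tilde_pos | apply powerRZ_lt, kappa_pos].
Qed.

Lemma psi_ratio_plus (n : nat) :
  psi K (Z.of_nat n) / psi K (Z.of_nat (S n)) =
  K (Z.of_nat (S n)) 0%Z / K 1%Z (Z.of_nat n) * kappa K.
Proof.
unfold psi. rewrite psi_tilde_succ.
replace (- Z.abs (Z.of_nat (S n)))%Z with (- Z.abs (Z.of_nat n) + -1)%Z by lia.
pose proof kappa_pos.
rewrite powerRZ_add by lra.
assert (0 < powerRZ (kappa K) (- Z.abs (Z.of_nat n))) by (now apply powerRZ_lt).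
pose proof (psi_tilde_pos (Z.of_nat n)).
pose proof (K_pos 1 (Z.of_nat n)). pose proof (K_pos (Z.of_nat (S n)) 0).
change (powerRZ (kappa K) (-1)) with (/ (kappa K * 1)).
field. repeat split; lra.
Qed.

Lemma psi_ratio_minus (n : nat) :
  psi K (- Z.of_nat n) / psi K (- Z.of_nat (S n)) =
  K 0%Z (- Z.of_nat (S n))%Z / K (- Z.of_nat n)%Z (-1)%Z * kappa K.
Proof.
unfold psi. rewrite psi_tilde_pred.
replace (- Z.abs (- Z.of_nat (S n)))%Z with (- Z.abs (- Z.of_nat n) + -1)%Z
  by lia.
pose proof kappa_pos.
rewrite powerRZ_add by lra.
assert (0 < powerRZ (kappa K) (- Z.abs (- Z.of_nat n)))
  by (now apply powerRZ_lt).
pose proof (psi_tilde_pos (- Z.of_nat n)).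
pose proof (K_pos (- Z.of_nat n) (-1)). pose proof (K_pos 0 (- Z.of_nat (S n))).
change (powerRZ (kappa K) (-1)) with (/ (kappa K * 1)).
field. repeat split; lra.
Qed.

Lemma Rbar_mult_kappa_pos (L : Rbar) :
  Rbar_lt 0 L -> Rbar_lt 0 (Rbar_mult L (kappa K)).
Proof.
intro HL. pose proof kappa_pos.
replace (Finite 0) with (Rbar_mult 0 (kappa K)) by (simpl; f_equal; ring).
destruct L as [l| |]; simpl in HL; try contradiction.
- simpl. now apply Rmult_lt_compat_r.
- unfold Rbar_mult, Rbar_mult'.
  destruct (Rle_dec 0 (kappa K)) as [h|]; [|lra].
  destruct (Rle_lt_or_eq_dec 0 (kappa K) h); [simpl; auto | lra].
Qed.

Lemma CV_radius_psi_plus (L : Rbar) :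
  Rbar_lt 0 L -> is_Lambda_plus K L ->
  CV_radius (fun n => psi K (Z.of_nat n)) = Rbar_mult L (kappa K).
Proof.
intros HL Hlim.
apply CV_radius_of_ratio.
- intro n; apply psi_pos.
- now apply Rbar_mult_kappa_pos.
- apply is_lim_seq_ext with
    (fun n => K (Z.of_nat (S n)) 0%Z / K 1%Z (Z.of_nat n) * kappa K).
  + intro n. now rewrite psi_ratio_plus.
  + apply is_lim_seq_scal_r.
    (* The quotient of the coefficients [n] and [n + 1] is [kappa] times the term of the limit
       sequence with [j = n + 1]. *)
    apply (is_lim_seq_incr_n _ 1) in Hlim.
    revert Hlim. apply is_lim_seq_ext. intro n. cbv zeta.
    now replace (Z.of_nat (n + 1) - 1)%Z with (Z.of_nat n) by lia;
      replace (n + 1)%nat with (S n) by lia.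
Qed.

Lemma CV_radius_psi_minus (L : Rbar) :
  Rbar_lt 0 L -> is_Lambda_minus K L ->
  CV_radius (fun n => psi K (- Z.of_nat (S n))) = Rbar_mult L (kappa K).
Proof.
intros HL Hlim.
apply CV_radius_of_ratio.
- intro n; apply psi_pos.
- now apply Rbar_mult_kappa_pos.
- apply is_lim_seq_ext with
    (fun n => K 0%Z (- Z.of_nat (S (S n)))%Z
              / K (- Z.of_nat (S n))%Z (-1)%Z * kappa K).
  + intro n. now rewrite psi_ratio_minus.
  + apply is_lim_seq_scal_r.
    (* Coefficient [n] belongs to the exponent [-(n + 1)], so the quotient compares the exponents
       [-(n + 1)] and [-(n + 2)]; hence a shift by two. *)
    apply (is_lim_seq_incr_n _ 2) in Hlim.
    revert Hlim. apply is_lim_seq_ext. intro n. cbv zeta.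
    now replace (- Z.of_nat (n + 2) + 1)%Z with (- Z.of_nat (S n))%Z by lia;
      replace (n + 2)%nat with (S (S n)) by lia.
Qed.

End Psi.

(** * Laurent series with positive argument *)

Definition laurent (w : Z -> R) (x : R) : R :=
  SeriesZ (fun k => w k * powerRZ x k).

(** The negative half is a power series in [/ x], up to one factor [/ x] that does not affect the
    radius. Bounding [/ x] from above avoids inverting a radius that may be infinite or zero. *)
Definition in_annulus (w : Z -> R) (x : R) : Prop :=
  0 < x /\
  Rbar_lt x (CV_radius (fun n => w (Z.of_nat n))) /\
  Rbar_lt (/ x) (CV_radius (fun n => w (- Z.of_nat (S n))%Z)).

Lemma powerRZ_opp_S (x : R) (n : nat) :
  powerRZ x (- Z.of_nat (S n)) = / x * (/ x) ^ n.
Proof.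
rewrite pow_inv, <- Rinv_mult.
change (powerRZ x (- Z.of_nat (S n)))
  with (/ x ^ Pos.to_nat (Pos.of_succ_nat n)).
now rewrite SuccNat2Pos.id_succ.
Qed.

(** [PS_incr_1] supplies the zero constant term of the negative half. No convergence is assumed, so
    the identity can replace [laurent w] as a function. *)
Lemma laurent_PSeries (w : Z -> R) (x : R) :
  laurent w x =
  PSeries (fun n => w (Z.of_nat n)) x
  + PSeries (PS_incr_1 (fun n => w (- Z.of_nat (S n))%Z)) (/ x).
Proof.
unfold laurent, SeriesZ. rewrite PSeries_incr_1. unfold PSeries.
rewrite <- Series_scal_l. f_equal; apply Series_ext; intro n.
- now rewrite <- pow_powerRZ.
- rewrite powerRZ_opp_S.
  change (w (- Z.of_nat (S n))%Z * (/ x * (/ x) ^ n) =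
    / x * (w (- Z.of_nat (S n))%Z * (/ x) ^ n)). ring.
Qed.

Lemma ex_seriesZ_laurent_abs (w : Z -> R) (x : R) :
  in_annulus w x -> ex_seriesZ (fun k => Rabs (w k) * powerRZ x k).
Proof.
intros [Hx [Hp Hm]].
assert (0 < / x) by (now apply Rinv_0_lt_compat).
split.
- rewrite <- (Rabs_pos_eq x) in Hp by lra.
  apply CV_disk_inside in Hp.
  revert Hp. apply ex_series_ext. intro n.
  rewrite Rabs_mult, <- pow_powerRZ, (Rabs_pos_eq (x ^ n)); auto.
  apply pow_le; lra.
- rewrite <- (Rabs_pos_eq (/ x)) in Hm by lra.
  apply CV_disk_inside, (ex_series_scal_r (/ x)) in Hm.
  revert Hm. apply ex_series_ext. intro n.
  rewrite Rabs_mult, powerRZ_opp_S, (Rabs_pos_eq ((/ x) ^ n)).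
  + rewrite (Rmult_comm (/ x)). apply Rmult_assoc.
  + apply pow_le; lra.
Qed.

Lemma ex_seriesZ_laurent (w : Z -> R) (x : R) :
  in_annulus w x -> ex_seriesZ (fun k => w k * powerRZ x k).
Proof.
intros Hw. destruct (ex_seriesZ_laurent_abs w x Hw) as [H1 H2].
split; apply ex_series_Rabs; [revert H1 | revert H2]; apply ex_series_ext;
  intro n; rewrite Rabs_mult; f_equal; symmetry;
  apply Rabs_pos_eq, Rlt_le, powerRZ_lt, Hw.
Qed.

Lemma ex_seriesZ_plus (u v : Z -> R) :
  ex_seriesZ u -> ex_seriesZ v -> ex_seriesZ (fun k => u k + v k).
Proof.
intros [Hu1 Hu2] [Hv1 Hv2].
split; [apply (ex_series_plus _ _ Hu1 Hv1) | apply (ex_series_plus _ _ Hu2 Hv2)].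
Qed.

Lemma ex_seriesZ_scal_r (c : R) (u : Z -> R) :
  ex_seriesZ u -> ex_seriesZ (fun k => u k * c).
Proof.
intros [Hu1 Hu2].
split; [apply (ex_series_scal_r c _ Hu1) | apply (ex_series_scal_r c _ Hu2)].
Qed.

Lemma ex_seriesZ_ext (u v : Z -> R) :
  (forall k, u k = v k) -> ex_seriesZ u -> ex_seriesZ v.
Proof.
intros E [H1 H2].
split; [revert H1 | revert H2]; apply ex_series_ext; intro n; apply E.
Qed.

Lemma SeriesZ_ext (u v : Z -> R) :
  (forall k, u k = v k) -> SeriesZ u = SeriesZ v.
Proof. intro E. unfold SeriesZ. f_equal; apply Series_ext; intro n; apply E. Qed.

Lemma SeriesZ_scal_r (c : R) (u : Z -> R) :
  SeriesZ (fun k => u k * c) = SeriesZ u * c.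
Proof. unfold SeriesZ. rewrite 2!Series_scal_r. ring. Qed.

Lemma SeriesZ_plus (u v : Z -> R) :
  ex_seriesZ u -> ex_seriesZ v ->
  SeriesZ (fun k => u k + v k) = SeriesZ u + SeriesZ v.
Proof.
intros [Hu1 Hu2] [Hv1 Hv2]. unfold SeriesZ.
rewrite (Series_plus _ _ Hu1 Hv1), (Series_plus _ _ Hu2 Hv2). ring.
Qed.

(** Two terms are singled out because in the variance either one of them may vanish, but not
    both. *)
Lemma SeriesZ_pos (u : Z -> R) :
  (forall k, 0 <= u k) -> 0 < u 0%Z + u 1%Z -> ex_seriesZ u -> 0 < SeriesZ u.
Proof.
intros Hu H01 [H1 H2]. unfold SeriesZ.
rewrite (Series_incr_1 _ H1).
assert (H1' := proj1 (ex_series_incr_1 _) H1).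
rewrite (Series_incr_1 _ H1').
assert (H1'' := proj1 (ex_series_incr_1 _) H1').
assert (A := Series_ge0 _ (fun n => Hu _) H1'').
assert (B := Series_ge0 _ (fun n => Hu _) H2).
cbv beta in *. change (Z.of_nat 0) with 0%Z. change (Z.of_nat 1) with 1%Z.
lra.
Qed.

(** * The Euler operator [x d/dx] on Laurent series *)

(** On coefficients, [x d/dx] is differentiation followed by a shift; neither changes the radius of
    convergence. *)
Lemma euler_plus_PS_incr (w : Z -> R) (n : nat) :
  IZR (Z.of_nat n) * w (Z.of_nat n) =
  PS_incr_1 (PS_derive (fun n => w (Z.of_nat n))) n.
Proof.
destruct n as [|n]; [apply Rmult_0_l|].
unfold PS_incr_1, PS_derive. now rewrite INR_IZR_INZ.
Qed.

Lemma CV_radius_euler_plus (w : Z -> R) :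
  CV_radius (fun n => IZR (Z.of_nat n) * w (Z.of_nat n)) =
  CV_radius (fun n => w (Z.of_nat n)).
Proof.
rewrite (CV_radius_ext _ _ (euler_plus_PS_incr w)).
now rewrite CV_radius_incr_1, CV_radius_derive.
Qed.

(** With [y = / x] one has [x d/dx = - y d/dy], whence the sign. The shift now comes before the
    derivative, because coefficient [n] stands at [y^(n+1)]. *)
Lemma euler_minus_PS_opp (w : Z -> R) (n : nat) :
  IZR (- Z.of_nat (S n)) * w (- Z.of_nat (S n))%Z =
  PS_opp (PS_derive (PS_incr_1 (fun n => w (- Z.of_nat (S n))%Z))) n.
Proof.
unfold PS_opp, PS_derive. rewrite INR_IZR_INZ, opp_IZR.
apply Ropp_mult_distr_l_reverse.
Qed.

Lemma CV_radius_euler_minus (w : Z -> R) :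
  CV_radius (fun n => IZR (- Z.of_nat (S n)) * w (- Z.of_nat (S n))%Z) =
  CV_radius (fun n => w (- Z.of_nat (S n))%Z).
Proof.
rewrite (CV_radius_ext _ _ (euler_minus_PS_opp w)).
now rewrite CV_radius_opp, CV_radius_derive, CV_radius_incr_1.
Qed.

(** Can be iterated, so the moments of every order converge on the same annulus. *)
Lemma in_annulus_euler (w : Z -> R) (x : R) :
  in_annulus w x -> in_annulus (fun k => IZR k * w k) x.
Proof.
unfold in_annulus. now rewrite CV_radius_euler_plus, CV_radius_euler_minus.
Qed.

(** Both halves are differentiated termwise, the negative one through the chain rule for [y = / x];
    the Euler identities then reassemble the result. *)
Lemma is_derive_laurent (w : Z -> R) (x : R) :
  in_annulus w x ->
  is_derive (laurent w) x (laurent (fun k => IZR k * w k) x / x).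
Proof.
intros [Hx [Hp Hm]].
assert (Hx' : 0 < / x) by (now apply Rinv_0_lt_compat).
set (a := fun n => w (Z.of_nat n)) in *.
set (c := fun n => w (- Z.of_nat (S n))%Z) in *.
apply is_derive_ext with
  (fun y => PSeries a y + PSeries (PS_incr_1 c) (/ y)).
{ intro y. symmetry. apply laurent_PSeries. }
rewrite laurent_PSeries, PSeries_incr_1.
rewrite (PSeries_ext (fun n => IZR (- Z.of_nat (S n)) * _) _ _
  (euler_minus_PS_opp w)).
rewrite PSeries_opp. fold c.
rewrite (PSeries_ext (fun n => IZR (Z.of_nat n) * _) _ _
  (euler_plus_PS_incr w)).
rewrite PSeries_incr_1. fold a.
evar_last.
- apply @is_derive_plus.
  + apply is_derive_PSeries. now rewrite Rabs_pos_eq by lra.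
  + apply (is_derive_comp (PSeries (PS_incr_1 c)) Rinv).
    * apply is_derive_PSeries.
      now rewrite CV_radius_incr_1, Rabs_pos_eq by lra.
    * apply (is_derive_inv (fun y => y)); [apply @is_derive_id | lra].
- unfold plus, scal, one; simpl. unfold mult; simpl. field. lra.
Qed.


(** * The charge as a mean, and its derivative as a variance *)

Lemma charge_f_eq (K : Z -> Z -> R) (x : R) :
  charge (f_eq K x) =
  laurent (fun k => IZR k * psi K k) x / laurent (psi K) x.
Proof.
unfold charge, Rdiv, laurent at 1. rewrite <- SeriesZ_scal_r.
apply SeriesZ_ext. intro k. unfold f_eq, Rdiv.
change (partition_fun K x) with (laurent (psi K) x). ring.
Qed.

Lemma laurent_pos (w : Z -> R) (x : R) :
  (forall k, 0 < w k) -> in_annulus w x -> 0 < laurent w x.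
Proof.
intros Hw Hx.
assert (Hk : forall k, 0 < w k * powerRZ x k).
{ intro k. apply Rmult_lt_0_compat; [apply Hw | apply powerRZ_lt, Hx]. }
apply SeriesZ_pos.
- intro k. apply Rlt_le, Hk.
- now apply Rplus_lt_0_compat.
- now apply ex_seriesZ_laurent.
Qed.

(* The variance [sum (k - m)^2 w_k x^k] about the mean [m] is positive since
   [m] cannot equal both [0] and [1]. *)
Lemma laurent_moments_lt (w : Z -> R) (x : R) :
  (forall k, 0 < w k) -> in_annulus w x ->
  0 < laurent (fun k => IZR k * (IZR k * w k)) x * laurent w x
      - laurent (fun k => IZR k * w k) x * laurent (fun k => IZR k * w k) x.
Proof.
intros Hw Hx.
assert (H0 := laurent_pos w x Hw Hx).
assert (Hx1 := in_annulus_euler w x Hx).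
assert (Hx2 := in_annulus_euler _ x Hx1).
set (w1 := fun k => IZR k * w k) in *.
change (fun k => IZR k * (IZR k * w k)) with (fun k => IZR k * w1 k).
set (w2 := fun k => IZR k * w1 k) in *.
set (m := laurent w1 x / laurent w x).
assert (E0 := ex_seriesZ_scal_r (m ^ 2) _ (ex_seriesZ_laurent w x Hx)).
assert (E1 := ex_seriesZ_scal_r (- 2 * m) _ (ex_seriesZ_laurent w1 x Hx1)).
assert (E2 := ex_seriesZ_laurent w2 x Hx2).
assert (E10 := ex_seriesZ_plus _ _ E1 E0).
(* Expand the square as [k^2 - 2 m k + m^2] and sum the three convergent series separately. *)
assert (V : SeriesZ (fun k => (IZR k - m) ^ 2 * (w k * powerRZ x k)) =
  laurent w2 x + (laurent w1 x * (- 2 * m) + laurent w x * m ^ 2)).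
{ unfold laurent. rewrite <- 2!SeriesZ_scal_r.
  rewrite <- (SeriesZ_plus _ _ E1 E0), <- (SeriesZ_plus _ _ E2 E10).
  apply SeriesZ_ext. intro k. unfold w2, w1. ring. }
assert (Hk : forall k, 0 < w k * powerRZ x k).
{ intro k. apply Rmult_lt_0_compat; [apply Hw | apply powerRZ_lt, Hx]. }
assert (P : 0 < SeriesZ (fun k => (IZR k - m) ^ 2 * (w k * powerRZ x k))).
{ apply SeriesZ_pos.
  - intro k. apply Rmult_le_pos; [apply pow2_ge_0 | apply Rlt_le, Hk].
  - generalize (Hk 0%Z) (Hk 1%Z).
    generalize (w 0%Z * powerRZ x 0) (w 1%Z * powerRZ x 1). intros p q Hp Hq.
    (* If [m = 0], the term [k = 1] contributes [q > 0]; otherwise the term [k = 0] contributes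
       [m^2 p > 0]. *)
    destruct (Req_dec m 0) as [->|Hm].
    + nra.
    + assert (0 < m ^ 2) by (now apply pow2_gt_0).
      assert (0 <= (1 - m) ^ 2 * q)
        by (apply Rmult_le_pos; [apply pow2_ge_0 | lra]).
      assert (0 < m ^ 2 * p) by (now apply Rmult_lt_0_compat).
      replace ((0 - m) ^ 2) with (m ^ 2) by ring. lra.
  - apply ex_seriesZ_ext with (2 := ex_seriesZ_plus _ _ E2 E10).
    intro k. unfold w2, w1. ring. }
rewrite V in P.
(* Since [m = M_1 / M_0], the unnormalised variance times [M_0] is [M_2 M_0 - M_1^2]. *)
replace (laurent w2 x * laurent w x - laurent w1 x * laurent w1 x) with
  ((laurent w2 x + (laurent w1 x * (- 2 * m) + laurent w x * m ^ 2))
   * laurent w x) by (unfold m; field; lra).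
now apply Rmult_lt_0_compat.
Qed.

(** Quotient rule with [M_0' = M_1 / x] and [M_1' = M_2 / x]; the common [1 / x] goes into the
    denominator. *)
Lemma is_derive_laurent_quotient (w : Z -> R) (x : R) :
  (forall k, 0 < w k) -> in_annulus w x ->
  is_derive (fun y => laurent (fun k => IZR k * w k) y / laurent w y) x
    ((laurent (fun k => IZR k * (IZR k * w k)) x * laurent w x
      - laurent (fun k => IZR k * w k) x * laurent (fun k => IZR k * w k) x)
     / (x * laurent w x ^ 2)).
Proof.
intros Hw Hx.
assert (H0 := laurent_pos w x Hw Hx).
assert (Hx1 := in_annulus_euler w x Hx).
evar_last.
- apply is_derive_div.
  + apply (is_derive_laurent _ _ Hx1).
  + apply (is_derive_laurent _ _ Hx).
  + lra.
- simpl. destruct Hx as [Hx _]. field. lra.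
Qed.

(** * Application to [psi] on [I_K] *)

Lemma in_annulus_psi (K : Z -> Z -> R) (K_pos : forall i j : Z, 0 < K i j)
    (Lp Lm : Rbar) (x : R) :
  Rbar_lt 0 Lp -> is_Lambda_plus K Lp ->
  Rbar_lt 0 Lm -> is_Lambda_minus K Lm ->
  I_K K Lm Lp x -> in_annulus (psi K) x.
Proof.
intros Lp_pos Hp Lm_pos Hm [Hlo Hhi]. unfold in_annulus.
rewrite (CV_radius_psi_plus K K_pos Lp Lp_pos Hp).
rewrite (CV_radius_psi_minus K K_pos Lm Lm_pos Hm).
assert (P := Rbar_mult_kappa_pos K K_pos Lm Lm_pos).
(* For a finite radius [r] the lower bound [/ r < x] is inverted. For an infinite one the convention
   [Rbar_inv p_infty = 0] leaves just [0 < x], and the bound on [/ x] is trivial. *)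
destruct (Rbar_mult Lm (kappa K)) as [r| |]; simpl in Hlo, P |- *.
- assert (0 < / r) by (now apply Rinv_0_lt_compat).
  repeat split; [lra | assumption |].
  rewrite <- (Rinv_inv r). apply Rinv_lt_contravar; auto.
  apply Rmult_lt_0_compat; lra.
- auto.
- contradiction.
Qed.

Lemma open_I_K (K : Z -> Z -> R) (Lm Lp : Rbar) : open (I_K K Lm Lp).
Proof. apply open_and; [apply open_Rbar_gt | apply open_Rbar_lt]. Qed.

(** The weight [1 + |k|] splits the sum into the absolute Laurent series of [psi] and of its Euler
    transform. *)
Lemma ell11_f_eq (K : Z -> Z -> R) (x : R) :
  (forall k, 0 < psi K k) -> in_annulus (psi K) x -> ell11 (f_eq K x).
Proof.
intros Hpsi Hx.
assert (HZ : 0 < partition_fun K x) by (now apply laurent_pos).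
apply ex_seriesZ_ext with (fun k =>
  (Rabs (psi K k) * powerRZ x k + Rabs (IZR k * psi K k) * powerRZ x k)
  * / partition_fun K x).
- intro k. unfold f_eq, Rdiv.
  rewrite !Rabs_mult, Rabs_inv, (Rabs_pos_eq (partition_fun K x)),
    (Rabs_pos_eq (powerRZ x k)).
  + ring.
  + apply Rlt_le, powerRZ_lt, Hx.
  + lra.
- apply ex_seriesZ_scal_r, ex_seriesZ_plus.
  + now apply ex_seriesZ_laurent_abs.
  + apply (ex_seriesZ_laurent_abs (fun k => IZR k * psi K k)).
    now apply in_annulus_euler.
Qed.

Theorem lemma5p9 (K : Z -> Z -> R) (K_pos : forall i j : Z, 0 < K i j)
    (Lp Lm : Rbar)
    (Lp_pos : Rbar_lt 0 Lp) (Lp_lim : is_Lambda_plus K Lp)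
    (Lm_pos : Rbar_lt 0 Lm) (Lm_lim : is_Lambda_minus K Lm)
    (I_nonempty : exists phi : R, I_K K Lm Lp phi) :
  (forall phi : R, I_K K Lm Lp phi ->
     ex_seriesZ (fun l => psi K l * powerRZ phi l) /\ ell11 (f_eq K phi)) /\
  C1_on (I_K K Lm Lp) (fun phi => charge (f_eq K phi)) /\
  (forall phi : R, I_K K Lm Lp phi ->
     0 < Derive (fun phi => charge (f_eq K phi)) phi).
Proof.
assert (Hin : forall x, I_K K Lm Lp x -> in_annulus (psi K) x)
  by (intros x Hx; now apply (in_annulus_psi K K_pos Lp Lm)).
assert (Hpsi := psi_pos K K_pos).
set (w1 := fun k => IZR k * psi K k).
set (w2 := fun k => IZR k * w1 k).
set (M0 := laurent (psi K)). set (M1 := laurent w1). set (M2 := laurent w2).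
set (q' := fun x => (M2 x * M0 x - M1 x * M1 x) / (x * M0 x ^ 2)).
assert (D : forall x, I_K K Lm Lp x ->
  is_derive (fun phi => charge (f_eq K phi)) x (q' x)).
{ intros x Hx.
  apply is_derive_ext with (fun y => M1 y / M0 y).
  - intro y. symmetry. apply charge_f_eq.
  - apply is_derive_laurent_quotient; auto. }
split; [|split].
- intros x Hx. split.
  + now apply ex_seriesZ_laurent, Hin.
  + apply ell11_f_eq; auto.
- intros x Hx. split; [eexists; now apply D|].
  (* [Derive] is known to equal [q'] only on [I_K]; since [I_K] is open, they agree near [x], which
     is enough for continuity. *)
  apply continuous_ext_loc with q'.
  + apply locally_open with (I_K K Lm Lp); auto.
    * apply open_I_K.
    * intros y Hy. symmetry. now apply is_derive_unique, D.
  (* [q'] is a rational expression in [x] and the moments up to order two, all differentiable on the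
     annulus, with nonzero denominator. *)
  + apply @ex_derive_continuous.
    assert (H0 := Hin x Hx).
    assert (H1 := in_annulus_euler _ _ H0).
    assert (H2 := in_annulus_euler _ _ H1).
    assert (P := laurent_pos _ _ Hpsi H0).
    assert (D0 : ex_derive M0 x) by (eexists; now apply is_derive_laurent).
    assert (D1 : ex_derive M1 x) by (eexists; now apply is_derive_laurent).
    assert (D2 : ex_derive M2 x) by (eexists; now apply is_derive_laurent).
    unfold q'. auto_derive. repeat split; auto.
    destruct H0 as [Hx0 _]. apply Rgt_not_eq.
    apply Rmult_lt_0_compat; auto. simpl. fold M0 in P. nra.
- intros x Hx. rewrite (is_derive_unique (fun phi : R => charge (f_eq K phi)) x _ (D x Hx)).
  assert (H0 := Hin x Hx).
  apply Rdiv_lt_0_compat.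
  + now apply laurent_moments_lt.
  + apply Rmult_lt_0_compat; [apply H0|].
    apply pow_lt. now apply laurent_pos.
Qed.
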